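(* Let $A$ be a vector space. Then there is a one-one correspondence between associative-Yamaguti algebra structures on $A$ and Yamaguti multiplications on the endomorphism operad $\mathrm{End}_A$.
   Context: All vector spaces, linear maps and tensor products are over a field $\mathbf{k}$ of characteristic $0$. An associative-Yamaguti algebra structure on $A$ is a triple of linear operations $\cdot:A\otimes A\to A$ and $\{~,~,~\},\{\!\{~,~,~\}\!\}:A\otimes A\otimes A\to A$ such that for all $a,b,c,d,e\in A$: (AY1) $(a\cdot b)\cdot c-a\cdot(b\cdot c)+\{a,b,c\}-\{\!\{a,b,c\}\!\}=0$; (AY2) $\{a\cdot b,c,d\}=\{a,b\cdot c,d\}$; (AY3) $\{a,b,c\cdot d\}=\{a,b,c\}\cdot d$; (AY4) $\{\!\{a\cdot b,c,d\}\!\}=a\cdot\{\!\{b,c,d\}\!\}$; (AY5) $\{\!\{a,b\cdot c,d\}\!\}=\{\!\{a,b,c\cdot d\}\!\}$; (AY6) $a\cdot\{b,c,d\}=\{\!\{a,b,c\}\!\}\cdot d$; (AY7) $\{\{a,b,c\},d,e\}=\{a,\{\!\{b,c,d\}\!\},e\}=\{a,b,\{c,d,e\}\}$; (AY8) $\{a,\{b,c,d\},e\}=\{\{\!\{a,b,c\}\!\},d,e\}$; (AY9) $\{\!\{\{\!\{a,b,c\}\!\},d,e\}\!\}=\{\!\{a,\{b,c,d\},e\}\!\}=\{\!\{a,b,\{\!\{c,d,e\}\!\}\}\!\}$; (AY10) $\{\!\{a,\{\!\{b,c,d\}\!\},e\}\!\}=\{\!\{a,b,\{c,d,e\}\}\!\}$;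 (AY11) $\{a,b,\{\!\{c,d,e\}\!\}\}=\{\!\{\{a,b,c\},d,e\}\!\}$. The endomorphism operad $\mathrm{End}_A$ is the nonsymmetric operad with $\mathrm{End}_A(n)=\mathrm{Hom}(A^{\otimes n},A)$ for $n\ge1$, identity element $\mathrm{Id}_A$, and partial compositions $$(f\circ_ig)(a_1,\ldots,a_{m+n-1})=f(a_1,\ldots,a_{i-1},g(a_i,\ldots,a_{i+n-1}),a_{i+n},\ldots,a_{m+n-1})$$ for $f\in\mathrm{End}_A(m)$, $g\in\mathrm{End}_A(n)$, $1\le i\le m$. A Yamaguti multiplication on a nonsymmetric operad $\mathcal{P}$ (with partial compositions $\circ_i:\mathcal{P}(m)\otimes\mathcal{P}(n)\to\mathcal{P}(m+n-1)$) is a triple $(\pi,\theta,\vartheta)$ with $\pi\in\mathcal{P}(2)$ and $\theta,\vartheta\in\mathcal{P}(3)$ satisfying: $\pi\circ_1\pi-\pi\circ_2\pi+\theta-\vartheta=0$; $\theta\circ_1\pi=\theta\circ_2\pi$; $\theta\circ_3\pi=\pi\circ_1\theta$; $\vartheta\circ_1\pi=\pi\circ_2\vartheta$; $\vartheta\circ_2\pi=\vartheta\circ_3\pi$; $\pi\circ_2\theta=\pi\circ_1\vartheta$; $\theta\circ_1\theta=\theta\circ_2\vartheta=\theta\circ_3\theta$; $\theta\circ_2\theta=\theta\circ_1\vartheta$; $\vartheta\circ_1\vartheta=\vartheta\circ_2\theta=\vartheta\circ_3\vartheta$; $\vartheta\circ_2\vartheta=\vartheta\circ_3\theta$; $\theta\circ_3\vartheta=\vartheta\circ_1\theta$.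 *)

(* Defs.v *)
From HB Require Import structures.
From mathcomp Require Import all_boot all_order all_algebra.
From mathcomp Require Import boolp functions.
From mathcomp Require Import zify.

Set Implicit Arguments.
Unset Strict Implicit.
Unset Printing Implicit Defensive.

Import GRing.Theory.
Local Open Scope ring_scope.

(* Linear operations on tensor powers of A are represented by the multilinear
   operations that they correspond to under the universal property of the
   tensor product. *)

Definition trilinear (k : fieldType) (A : lmodType k) (f : A -> A -> A -> A) :=
  [/\ forall b c, linear (fun a => f a b c),
      forall a c, linear (fun b => f a b c)
    & forall a b, linear (fun c => f a b c)].

Record AY_structure (k : fieldType) (A : lmodType k) := AYStructure {
  ay_mul : A -> A -> A;
  ay_brl : A -> A -> A -> A;   (* { , , } *)
  ay_brr : A -> A -> A -> A;   (* {{ , , }} *)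
  ay_mul_bilin : bilinear_for *:%R *:%R ay_mul;
  ay_brl_trilin : trilinear ay_brl;
  ay_brr_trilin : trilinear ay_brr;
  AY1 : forall a b c,
    ay_mul (ay_mul a b) c - ay_mul a (ay_mul b c)
      + ay_brl a b c - ay_brr a b c = 0;
  AY2 : forall a b c d, ay_brl (ay_mul a b) c d = ay_brl a (ay_mul b c) d;
  AY3 : forall a b c d, ay_brl a b (ay_mul c d) = ay_mul (ay_brl a b c) d;
  AY4 : forall a b c d, ay_brr (ay_mul a b) c d = ay_mul a (ay_brr b c d);
  AY5 : forall a b c d, ay_brr a (ay_mul b c) d = ay_brr a b (ay_mul c d);
  AY6 : forall a b c d, ay_mul a (ay_brl b c d) = ay_mul (ay_brr a b c) d;
  AY7 : forall a b c d e,
    ay_brl (ay_brl a b c) d e = ay_brl a (ay_brr b c d) e /\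
    ay_brl a (ay_brr b c d) e = ay_brl a b (ay_brl c d e);
  AY8 : forall a b c d e,
    ay_brl a (ay_brl b c d) e = ay_brl (ay_brr a b c) d e;
  AY9 : forall a b c d e,
    ay_brr (ay_brr a b c) d e = ay_brr a (ay_brl b c d) e /\
    ay_brr a (ay_brl b c d) e = ay_brr a b (ay_brr c d e);
  AY10 : forall a b c d e,
    ay_brr a (ay_brr b c d) e = ay_brr a b (ay_brl c d e);
  AY11 : forall a b c d e,
    ay_brl a b (ay_brr c d e) = ay_brr (ay_brl a b c) d e
}.

(* Only the components P n with n >= 1 matter: every operation below takes
   operands of arity m.+1, so that m.+1 + n.+1 - 1 = (m + n).+1 involves no
   truncated subtraction.  The component P 0 is unused.
   The argument [i : 'I_m.+1] of [ns_circ] is 0-based; it is the i.+1-st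
   input of f that receives g. *)
Record nsOperad (k : fieldType) := NsOperad {
  ns_comp :> nat -> lmodType k;
  ns_id : ns_comp 1%N;
  ns_circ : forall m n : nat,
    ns_comp m.+1 -> 'I_m.+1 -> ns_comp n.+1 -> ns_comp (m + n).+1;
  ns_circ_bilin : forall (m n : nat) (i : 'I_m.+1),
    bilinear_for *:%R *:%R
      (fun (f : ns_comp m.+1) (g : ns_comp n.+1) => ns_circ f i g);
  ns_circ_seq : forall (l m n : nat) (f : ns_comp l.+1) (g : ns_comp m.+1)
      (h : ns_comp n.+1) (i : 'I_l.+1) (j : 'I_m.+1),
    ns_circ (ns_circ f i g) (inord (i + j)) h =
    ecast p (ns_comp p.+1) (addnA l m n) (ns_circ f i (ns_circ g j h));
  ns_circ_par : forall (l m n : nat) (f : ns_comp l.+1) (g : ns_comp m.+1)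
      (h : ns_comp n.+1) (i j : 'I_l.+1), (i < j)%N ->
    ns_circ (ns_circ f i g) (inord (j + m)) h =
    ecast p (ns_comp p.+1) (addnAC l n m)
      (ns_circ (ns_circ f j h) (inord i) g);
  ns_circ_idl : forall (n : nat) (g : ns_comp n.+1),
    ns_circ ns_id ord0 g = g;
  ns_circ_idr : forall (m : nat) (f : ns_comp m.+1) (i : 'I_m.+1),
    ns_circ f i ns_id = ecast p (ns_comp p.+1) (esym (addn0 m)) f
}.

(* The partial composition with its usual 1-based index. *)
Definition ns_pcomp (k : fieldType) (P : nsOperad k) (m n : nat)
    (f : P m.+1) (g : P n.+1) (i : nat) (lei : (i.-1 < m.+1)%N) :
    P (m + n).+1 :=
  ns_circ f (Ordinal lei) g.

(* i is a positive numeral; [isT] checks that it is at most the arity of f. *)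
Notation "f \o_[ i ] g" := (@ns_pcomp _ _ _ _ f g i%N isT)
  (at level 40, i at level 0, left associativity,
   format "f  \o_[ i ]  g") : ring_scope.

Record Yamaguti_mult (k : fieldType) (P : nsOperad k) := YamagutiMult {
  ym_pi : P 2%N;
  ym_theta : P 3%N;
  ym_vartheta : P 3%N;
  YM1 : ym_pi \o_[1] ym_pi - ym_pi \o_[2] ym_pi + ym_theta - ym_vartheta = 0;
  YM2 : ym_theta \o_[1] ym_pi = ym_theta \o_[2] ym_pi;
  YM3 : ym_theta \o_[3] ym_pi = ym_pi \o_[1] ym_theta;
  YM4 : ym_vartheta \o_[1] ym_pi = ym_pi \o_[2] ym_vartheta;
  YM5 : ym_vartheta \o_[2] ym_pi = ym_vartheta \o_[3] ym_pi;
  YM6 : ym_pi \o_[2] ym_theta = ym_pi \o_[1] ym_vartheta;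
  YM7 : ym_theta \o_[1] ym_theta = ym_theta \o_[2] ym_vartheta /\
        ym_theta \o_[2] ym_vartheta = ym_theta \o_[3] ym_theta;
  YM8 : ym_theta \o_[2] ym_theta = ym_theta \o_[1] ym_vartheta;
  YM9 : ym_vartheta \o_[1] ym_vartheta = ym_vartheta \o_[2] ym_theta /\
        ym_vartheta \o_[2] ym_theta = ym_vartheta \o_[3] ym_vartheta;
  YM10 : ym_vartheta \o_[2] ym_vartheta = ym_vartheta \o_[3] ym_theta;
  YM11 : ym_theta \o_[3] ym_vartheta = ym_vartheta \o_[1] ym_theta
}.

Section Multilinear.
Variables (k : fieldType) (A : lmodType k) (n : nat).

(* [dfwith v x] is v with its i-th entry replaced by x. *)
Definition multilinear (f : ('I_n -> A) -> A) :=
  forall (i : 'I_n) (v : 'I_n -> A),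
    linear (fun x : A => f (dfwith (T := fun=> A) v (i := i) x)).

Definition multilinear_pred : {pred ('I_n -> A) -> A} :=
  fun f => `[< multilinear f >].

Lemma multilinear_submod_closed : submod_closed multilinear_pred.
Proof.
split=> [|c f g /asboolP fl /asboolP gl]; apply/asboolP => i v a x y.
  by rewrite [LHS](_ : _ = 0) // scaler0 add0r.
have E w : (c *: f + g) w = c *: f w + g w by [].
rewrite !E fl gl !scalerDr !scalerA (mulrC a c).
by rewrite addrACA.
Qed.

HB.instance Definition _ := GRing.isSubmodClosed.Build k (('I_n -> A) -> A)
  multilinear_pred multilinear_submod_closed.

Record multilin := Multilin {
  mlfun :> ('I_n -> A) -> A;
  mlfun_subproof : mlfun \in multilinear_pred
}.

HB.instance Definition _ := [isSub for mlfun].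
HB.instance Definition _ := [Choice of multilin by <:].
HB.instance Definition _ := [SubChoice_isSubLmodule of multilin by <:].

Lemma mlfunP (f : multilin) : multilinear f.
Proof. by case: f => f /= /asboolP. Qed.

Lemma multilinP (f g : multilin) : (forall v, f v = g v) <-> f = g.
Proof. by split=> [fg|->//]; apply: val_inj; apply: funext. Qed.

Definition mkMultilin (f : ('I_n -> A) -> A) (fl : multilinear f) : multilin :=
  Multilin (introT (asboolP _) fl).

End Multilinear.

Section Endomorphism.
Variables (k : fieldType) (A : lmodType k).

(* The values [inord _] below never overflow. *)
Definition End_args m n (i : 'I_m.+1) (g : ('I_n.+1 -> A) -> A)
    (a : 'I_(m + n).+1 -> A) : 'I_m.+1 -> A :=
  fun j => if (j < i)%N then a (inord j)
           else if j == i then g (fun l : 'I_n.+1 => a (inord (i + l)))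
           else a (inord (j + n)).

Lemma dfwithE (N : nat) (v : 'I_N -> A) (i j : 'I_N) (x : A) :
  dfwith (T := fun=> A) v (i := i) x j = if i == j then x else v j.
Proof.
case: eqVneq => [<-|ij]; first by rewrite dfwith_in.
by rewrite dfwith_out.
Qed.

Lemma End_circ_subproof m n (f : multilin A m.+1) (i : 'I_m.+1)
    (g : multilin A n.+1) :
  multilinear (fun a => f (End_args i g a)).
Proof.
move=> l v.
have := ltn_ord l; have := ltn_ord i => lti ltl.
have inE N (p : nat) (q : 'I_N.+1) : (p < N.+1)%N -> (q == inord p) = (q == p :> nat).
  by move=> pN; rewrite -val_eqE /= inordK.
have inE' N (p : nat) (q : 'I_N.+1) : (p < N.+1)%N -> (inord p == q) = (p == q :> nat).
  by move=> pN; rewrite -val_eqE /= inordK.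
case: (ltnP l i) => li; last case: (leqP l (i + n)) => lin.
- suff E x : End_args i g (dfwith (T := fun=> A) v (i := l) x) =
      dfwith (T := fun=> A) (End_args i g v) (i := inord l) x.
    by move=> a x y /=; rewrite !E; exact: mlfunP.
  apply: funext => j; have := ltn_ord j => ltj.
  rewrite dfwithE /End_args inE'; last by lia.
  rewrite !dfwithE !inE; [|lia..].
  case: ltnP => ji; first by [].
  rewrite [RHS]ifF; last by lia.
  case: eqVneq => ij; last by rewrite ifF //; lia.
  congr (g _); apply: funext => p; have := ltn_ord p => ltp.
  by rewrite dfwithE inE ?ifF //; lia.
- suff E x : End_args i g (dfwith (T := fun=> A) v (i := l) x) =
      dfwith (T := fun=> A) (End_args i g v) (i := i)
        (g (dfwith (T := fun=> A) (fun p : 'I_n.+1 => v (inord (i + p)))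
                   (i := inord (l - i)) x)).
    move=> a x y /=; rewrite !E.
    by rewrite mlfunP (mlfunP f).
  apply: funext => j; have := ltn_ord j => ltj.
  rewrite dfwithE /End_args [i == j]eq_sym.
  case: eqVneq => ij; last first.
    move: ij; rewrite -val_eqE /= => ij.
    by case: ltnP => ji; rewrite dfwithE inE ?ifF //; lia.
  rewrite ij ltnn; congr (g _); apply: funext => p.
  have := ltn_ord p => ltp.
  rewrite !dfwithE inE ?inE'; [|lia..].
  by congr (if _ then _ else _); lia.
- suff E x : End_args i g (dfwith (T := fun=> A) v (i := l) x) =
      dfwith (T := fun=> A) (End_args i g v) (i := inord (l - n)) x.
    by move=> a x y /=; rewrite !E; exact: mlfunP.
  apply: funext => j; have := ltn_ord j => ltj.
  rewrite dfwithE /End_args inE'; last by lia.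
  rewrite !dfwithE !inE; [|lia..].
  case: ltnP => ji; first by rewrite !ifF //; lia.
  case: eqVneq => ij.
    rewrite ij [RHS]ifF; last by lia.
    congr (g _); apply: funext => p; have := ltn_ord p => ltp.
    by rewrite dfwithE inE ?ifF //; lia.
  by congr (if _ then _ else _); lia.
Qed.

Definition End_circ m n (f : multilin A m.+1) (i : 'I_m.+1)
    (g : multilin A n.+1) : multilin A (m + n).+1 :=
  mkMultilin (End_circ_subproof f i g).

Lemma End_id_subproof : multilinear (fun a : 'I_1 -> A => a ord0).
Proof.
by move=> i v a x y; rewrite !dfwithE !ord1 eqxx.
Qed.

Definition End_id : multilin A 1%N := mkMultilin End_id_subproof.

(* Restrictions of sequences nat -> A reach all arguments, without [inord]. *)
Lemma multilin_natP N (f g : multilin A N.+1) :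
  (forall b : nat -> A, f (fun i => b i) = g (fun i => b i)) -> f = g.
Proof.
move=> fg; apply/multilinP => v.
have -> : v = (fun i : 'I_N.+1 => (fun p => v (inord p)) (i : nat)).
  by apply: funext => i; rewrite inord_val.
exact: (fg (fun p => v (inord p))).
Qed.

Lemma End_circE m n (f : multilin A m.+1) (i : 'I_m.+1) (g : multilin A n.+1)
    (b : nat -> A) :
  End_circ f i g (fun p => b p) =
  f (fun j => if (j < i)%N then b j
              else if j == i :> nat then g (fun p => b (i + p)%N)
              else b (j + n)%N).
Proof.
rewrite /End_circ /=; congr (f _); apply: funext => j; rewrite /End_args.
have := ltn_ord j; have := ltn_ord i => lti ltj.
case: ltnP => ji; first by rewrite inordK //; lia.
rewrite -val_eqE /=; case: eqVneq => ij; last by rewrite inordK //; lia.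
congr (g _); apply: funext => p; have := ltn_ord p => ltp.
by rewrite inordK //; lia.
Qed.

Lemma ecast_multilinE p q (e : p = q) (f : multilin A p.+1) (b : nat -> A) :
  (ecast r (multilin A r.+1) e f) (fun i => b i) = f (fun i => b i).
Proof. by case: q / e. Qed.

Lemma End_circ_bilin m n (i : 'I_m.+1) :
  bilinear_for *:%R *:%R
    (fun (f : multilin A m.+1) (g : multilin A n.+1) => End_circ f i g).
Proof.
split=> [g c f f'|f c g g']; apply/multilinP => v //.
have E (h : multilin A n.+1) : End_args i h v =
    dfwith (T := fun=> A) (End_args i (fun=> 0) v) (i := i)
      (h (fun l => v (inord (i + l)))).
  apply: funext => j; rewrite dfwithE /End_args -!val_eqE /=.
  by case: (ltngtP j i).
have F h : End_circ f i h v = f (End_args i h v) by [].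
have G : (c *: End_circ f i g + End_circ f i g') v =
  c *: End_circ f i g v + End_circ f i g' v by [].
by rewrite G !F !E -(mlfunP f).
Qed.

Lemma End_circ_seq l m n (f : multilin A l.+1) (g : multilin A m.+1)
    (h : multilin A n.+1) (i : 'I_l.+1) (j : 'I_m.+1) :
  End_circ (End_circ f i g) (inord (i + j)) h =
  ecast p (multilin A p.+1) (addnA l m n) (End_circ f i (End_circ g j h)).
Proof.
apply: multilin_natP => b; rewrite ecast_multilinE !End_circE.
have := ltn_ord i; have := ltn_ord j => ltj lti.
rewrite inordK; last by lia.
rewrite (End_circE f i g (fun p : nat => if (p < i + j)%N then b p else
  if p == (i + j)%N then h (fun q => b (i + j + q)%N) else b (p + n)%N)).
congr (f _); apply: funext => p.
case: (ltngtP p i) => pi.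
- by rewrite ifT //; lia.
- rewrite ifF; last by lia.
  rewrite ifF; last by lia.
  by congr b; lia.
- rewrite (End_circE g j h (fun q => b (i + q)%N)).
  congr (g _); apply: funext => q.
  rewrite ltn_add2l eqn_add2l; case: ltngtP => // qj.
  + by congr b; lia.
  + by congr (h _); apply: funext => r; congr b; lia.
Qed.

Lemma End_circ_par l m n (f : multilin A l.+1) (g : multilin A m.+1)
    (h : multilin A n.+1) (i j : 'I_l.+1) : (i < j)%N ->
  End_circ (End_circ f i g) (inord (j + m)) h =
  ecast p (multilin A p.+1) (addnAC l n m)
    (End_circ (End_circ f j h) (inord i) g).
Proof.
move=> ij; apply: multilin_natP => b; rewrite ecast_multilinE !End_circE.
have := ltn_ord i; have := ltn_ord j => ltj lti.
rewrite !inordK; [|lia..].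
rewrite (End_circE f i g (fun p : nat => if (p < j + m)%N then b p else
  if p == (j + m)%N then h (fun q => b (j + m + q)%N) else b (p + n)%N)).
rewrite (End_circE f j h (fun p : nat => if (p < i)%N then b p else
  if p == i then g (fun q => b (i + q)%N) else b (p + m)%N)).
congr (f _); apply: funext => p.
case: (ltngtP p i) => pi.
- by rewrite !ifT //; lia.
- case: (ltngtP p j) => pj.
  + by rewrite ifT //; lia.
  + rewrite ifF; last by lia.
    rewrite !ifF; [|lia..].
    by congr b; lia.
  + rewrite ifF; last by lia.
    rewrite ifT; last by lia.
    congr (h _); apply: funext => q.
    by rewrite !ifF; [congr b|..]; lia.
- rewrite ifT; last by lia.
  congr (g _); apply: funext => q; have := ltn_ord q => ltq.
  by rewrite ifT //; lia.
Qed.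

Lemma End_circ_idl n (g : multilin A n.+1) : End_circ End_id ord0 g = g.
Proof. by apply: multilin_natP => b; rewrite (End_circE End_id ord0 g). Qed.

Lemma End_circ_idr m (f : multilin A m.+1) (i : 'I_m.+1) :
  End_circ f i End_id = ecast p (multilin A p.+1) (esym (addn0 m)) f.
Proof.
apply: multilin_natP => b; rewrite ecast_multilinE End_circE.
congr (f _); apply: funext => p; rewrite /= !addn0.
by case: (ltngtP p i) => // ->.
Qed.

Definition End_operad : nsOperad k :=
  NsOperad End_circ_bilin End_circ_seq End_circ_par End_circ_idl
    End_circ_idr.

End Endomorphism.

(* Main.v *)
(* A multilinear operation is determined by its values on tuples of arguments,
   so bilinear (resp. trilinear) operations on A are the same as elements of
   End_A(2) (resp. End_A(3)).  Evaluated on tuples of arguments, (YM1)-(YM11)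
   become (AY1)-(AY11). *)
Require Import Defs.
From mathcomp Require Import all_boot all_order all_algebra.
From mathcomp Require Import boolp.

Import GRing.Theory.
Local Open Scope ring_scope.

Section SmallArity.
Variables (k : fieldType) (A : lmodType k).

(** With [nth], the argument tuple is the restriction of a sequence [nat -> A], the form that
    [multilin_natP] and [End_circE] handle. The default 0 is never reached. *)
Definition ev2 (f : multilin A 2) (a b : A) : A :=
  f (fun i => nth 0 [:: a; b] i).

Definition ev3 (f : multilin A 3) (a b c : A) : A :=
  f (fun i => nth 0 [:: a; b; c] i).

Lemma ev2E (f : multilin A 2) (v : nat -> A) :
  f (fun i => v i) = ev2 f (v 0) (v 1).
Proof. by congr (f _); apply: funext => -[[|[|[]]] lti]. Qed.

Lemma ev3E (f : multilin A 3) (v : nat -> A) :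
  f (fun i => v i) = ev3 f (v 0) (v 1) (v 2%N).
Proof. by congr (f _); apply: funext => -[[|[|[|[]]]] lti]. Qed.

(** Varying one argument is a [dfwith] update of the tuple, so [mlfunP] applies slot by slot. *)
Lemma ev2_bilinear (f : multilin A 2) : bilinear_for *:%R *:%R (ev2 f).
Proof.
pose v (a b : A) (i : 'I_2) := nth 0 [:: a; b] i.
have E0 a b x : ev2 f x b =
    f (dfwith (T := fun=> A) (v a b) (i := inord 0) x).
  congr (f _); apply: funext => -[[|[|[]]] lti] //;
  by rewrite dfwithE -val_eqE /= inordK.
have E1 a b x : ev2 f a x =
    f (dfwith (T := fun=> A) (v a b) (i := inord 1) x).
  congr (f _); apply: funext => -[[|[|[]]] lti] //;
  by rewrite dfwithE -val_eqE /= inordK.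
(* The old entry of the updated slot is overwritten, so it may be fixed to 0 throughout. *)
by split=> b c x y /=; [rewrite !(E0 0)|rewrite !(E1 _ 0)]; rewrite mlfunP.
Qed.

Lemma ev3_trilinear (f : multilin A 3) : trilinear (ev3 f).
Proof.
pose v (a b c : A) (i : 'I_3) := nth 0 [:: a; b; c] i.
have E0 a b c x : ev3 f x b c =
    f (dfwith (T := fun=> A) (v a b c) (i := inord 0) x).
  congr (f _); apply: funext => -[[|[|[|[]]]] lti] //;
  by rewrite dfwithE -val_eqE /= inordK.
have E1 a b c x : ev3 f a x c =
    f (dfwith (T := fun=> A) (v a b c) (i := inord 1) x).
  congr (f _); apply: funext => -[[|[|[|[]]]] lti] //;
  by rewrite dfwithE -val_eqE /= inordK.
have E2 a b c x : ev3 f a b x =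
    f (dfwith (T := fun=> A) (v a b c) (i := inord 2%N) x).
  congr (f _); apply: funext => -[[|[|[|[]]]] lti] //;
  by rewrite dfwithE -val_eqE /= inordK.
by split=> a b c x y; [rewrite !(E0 0)|rewrite !(E1 _ 0)|rewrite !(E2 _ _ 0)];
  rewrite mlfunP.
Qed.

Lemma multilinear2 (f : A -> A -> A) : bilinear_for *:%R *:%R f ->
  multilinear (fun v : 'I_2 -> A => f (v (inord 0)) (v (inord 1))).
Proof.
move=> [f1 f2] [[|[|[]]] lti] v c x y //=;
  rewrite !dfwithE -!val_eqE /= !inordK //=; [exact: f1|exact: f2].
Qed.

Lemma multilinear3 (f : A -> A -> A -> A) : trilinear f ->
  multilinear (fun v : 'I_3 -> A =>
    f (v (inord 0)) (v (inord 1)) (v (inord 2%N))).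
Proof.
move=> [f1 f2 f3] [[|[|[|[]]]] lti] v c x y //=;
  rewrite !dfwithE -!val_eqE /= !inordK //=; [exact: f1|exact: f2|exact: f3].
Qed.

Lemma ev2_surj (f : A -> A -> A) :
  bilinear_for *:%R *:%R f -> exists p, ev2 p = f.
Proof.
move=> fl; exists (mkMultilin (multilinear2 _ fl)).
by apply/funext => a; apply/funext => b; rewrite /ev2 /= !inordK.
Qed.

Lemma ev3_surj (f : A -> A -> A -> A) :
  trilinear f -> exists t, ev3 t = f.
Proof.
move=> fl; exists (mkMultilin (multilinear3 _ fl)).
apply/funext => a; apply/funext => b; apply/funext => c.
by rewrite /ev3 /= !inordK.
Qed.

Lemma ev2_inj : injective ev2.
Proof. by move=> f g fg; apply: multilin_natP => b; rewrite !ev2E fg. Qed.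

Lemma ev3_inj : injective ev3.
Proof. by move=> f g fg; apply: multilin_natP => b; rewrite !ev3E fg. Qed.

Local Notation P := (End_operad A).

(** One sequence supplies the arguments in every arity, so composites of arity [(m + n).+1] are
    evaluated without casts. *)
Definition evs {n} (f : P n) (b : nat -> A) : A :=
  (f : multilin A n) (fun i => b i).

Lemma evs_pcomp2 (p : P 2%N) n (g : P n.+1) b :
  (evs (p \o_[1] g) b = ev2 p (evs g b) (b n.+1)) *
  (evs (p \o_[2] g) b = ev2 p (b 0) (evs g (b \o succn))).
Proof.
(* [v i] is the argument sequence that [End_circE] passes to [p] when [g] fills the 0-based slot
   [i]: [g] reads [b] from index [i] on, and later inputs move by [n]. *)
pose v i j := if (j < i)%N then b j
  else if j == i then evs g (fun l => b (i + l)%N) else b (j + n)%N.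
by split; rewrite /evs [LHS]End_circE;
  [exact: (ev2E p (v 0))|exact: (ev2E p (v 1))].
Qed.

Lemma evs_pcomp3 (t : P 3%N) n (g : P n.+1) b :
  (evs (t \o_[1] g) b = ev3 t (evs g b) (b n.+1) (b n.+2)) *
  (evs (t \o_[2] g) b = ev3 t (b 0) (evs g (b \o succn)) (b n.+2)) *
  (evs (t \o_[3] g) b =
     ev3 t (b 0) (b 1) (evs g (b \o succn \o succn))).
Proof.
pose v i j := if (j < i)%N then b j
  else if j == i then evs g (fun l => b (i + l)%N) else b (j + n)%N.
by do !split; rewrite /evs [LHS]End_circE;
  [exact: (ev3E t (v 0))|exact: (ev3E t (v 1))|exact: (ev3E t (v 2%N))].
Qed.

Lemma evs2E (p : P 2%N) b : evs p b = ev2 p (b 0) (b 1).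
Proof. exact: ev2E. Qed.

Lemma evs3E (t : P 3%N) b : evs t b = ev3 t (b 0) (b 1) (b 2%N).
Proof. exact: ev3E. Qed.

Lemma evsD n (f g : P n) b : evs (f + g) b = evs f b + evs g b.
Proof. by []. Qed.

Lemma evsN n (f : P n) b : evs (- f) b = - evs f b.
Proof. by []. Qed.

Lemma evs0 n b : evs (0 : P n) b = 0.
Proof. by []. Qed.

(** A composite of two binary operations also has arity 3, so the composition rules precede
    [evs3E]. *)
Definition evsE := (evsD, evsN, evs0, evs_pcomp2, evs_pcomp3, evs2E, evs3E).

Lemma evs_inj n (f g : P n.+1) : (forall b, evs f b = evs g b) -> f = g.
Proof. exact: multilin_natP. Qed.

(** The correspondence is first a relation: existence and uniqueness of a partner on each side will
    give mutually inverse maps. *)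
Definition same_operations (s : AY_structure A) (m : Yamaguti_mult P) :=
  [/\ ev2 (ym_pi m) = ay_mul s, ev3 (ym_theta m) = ay_brl s
    & ev3 (ym_vartheta m) = ay_brr s].

Lemma AY_to_Yamaguti s : exists m, same_operations s m.
Proof.
have [p Ep] : exists p : P 2%N, ev2 p = ay_mul s.
  exact/ev2_surj/ay_mul_bilin.
have [t Et] : exists t : P 3%N, ev3 t = ay_brl s.
  exact/ev3_surj/ay_brl_trilin.
have [u Eu] : exists u : P 3%N, ev3 u = ay_brr s.
  exact/ev3_surj/ay_brr_trilin.
(* [by split] settles [same_operations], and [split] separates the two chains of equalities. Each
   remaining axiom becomes its algebra counterpart at [b 0], [b 1], and so on. *)
unshelve eexists; first apply: (@YamagutiMult _ P p t u);
  do ?[by split|split];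
  apply: evs_inj => b; rewrite !evsE ?Ep ?Et ?Eu /=.
- exact: AY1.
- exact: AY2.
- exact: AY3.
- exact: AY4.
- exact: AY5.
- exact: AY6.
- exact: (AY7 _ _ _ _ _ _).1.
- exact: (AY7 _ _ _ _ _ _).2.
- exact: AY8.
- exact: (AY9 _ _ _ _ _ _).1.
- exact: (AY9 _ _ _ _ _ _).2.
- exact: AY10.
- exact: AY11.
Qed.

Lemma Yamaguti_to_AY m : exists s, same_operations s m.
Proof.
(* A list of arguments, padded by zeros, is a sequence on which an operadic identity can be
   evaluated. *)
have ev l n (f g : P n) : f = g -> evs f (nth 0 l) = evs g (nth 0 l).
  by move->.
unshelve eexists; first apply: (@AYStructure _ A
   (ev2 (ym_pi m)) (ev3 (ym_theta m)) (ev3 (ym_vartheta m))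
   (ev2_bilinear _) (ev3_trilinear _) (ev3_trilinear _)); last by split.
- by move=> a b c; have := ev [:: a; b; c] _ _ _ (YM1 m); rewrite !evsE.
- by move=> a b c d; have := ev [:: a; b; c; d] _ _ _ (YM2 m); rewrite !evsE.
- by move=> a b c d; have := ev [:: a; b; c; d] _ _ _ (YM3 m); rewrite !evsE.
- by move=> a b c d; have := ev [:: a; b; c; d] _ _ _ (YM4 m); rewrite !evsE.
- by move=> a b c d; have := ev [:: a; b; c; d] _ _ _ (YM5 m); rewrite !evsE.
- by move=> a b c d; have := ev [:: a; b; c; d] _ _ _ (YM6 m); rewrite !evsE.
- move=> a b c d e; have [eq1 eq2] := YM7 m; split.
  + by have := ev [:: a; b; c; d; e] _ _ _ eq1; rewrite !evsE.
  + by have := ev [:: a; b; c; d; e] _ _ _ eq2; rewrite !evsE.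
- by move=> a b c d e; have := ev [:: a; b; c; d; e] _ _ _ (YM8 m);
    rewrite !evsE.
- move=> a b c d e; have [eq1 eq2] := YM9 m; split.
  + by have := ev [:: a; b; c; d; e] _ _ _ eq1; rewrite !evsE.
  + by have := ev [:: a; b; c; d; e] _ _ _ eq2; rewrite !evsE.
- by move=> a b c d e; have := ev [:: a; b; c; d; e] _ _ _ (YM10 m);
    rewrite !evsE.
- by move=> a b c d e; have := ev [:: a; b; c; d; e] _ _ _ (YM11 m);
    rewrite !evsE.
Qed.

(** Injectivity of [ev2] and [ev3] identifies the operations; the axioms are propositions, so proof
    irrelevance identifies the rest of the records. *)
Lemma AY_to_Yamaguti_uniq s m m' :
  same_operations s m -> same_operations s m' -> m = m'.
Proof.
move=> [Ep Et Eu] [Ep' Et' Eu'].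
have E1 : ym_pi m = ym_pi m' by apply: ev2_inj; rewrite Ep.
have E2 : ym_theta m = ym_theta m' by apply: ev3_inj; rewrite Et.
have E3 : ym_vartheta m = ym_vartheta m' by apply: ev3_inj; rewrite Eu.
clear Ep Et Eu Ep' Et' Eu'.
destruct m, m'; simpl in *; subst.
by congr YamagutiMult; exact: Prop_irrelevance.
Qed.

Lemma Yamaguti_to_AY_uniq s s' m :
  same_operations s m -> same_operations s' m -> s = s'.
Proof.
move=> [Ep Et Eu] [Ep' Et' Eu'].
have E1 : ay_mul s = ay_mul s' by rewrite -Ep.
have E2 : ay_brl s = ay_brl s' by rewrite -Et.
have E3 : ay_brr s = ay_brr s' by rewrite -Eu.
clear Ep Et Eu Ep' Et' Eu'.
destruct s, s'; simpl in *; subst.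
by congr AYStructure; exact: Prop_irrelevance.
Qed.
End SmallArity.

Theorem theorem6p6 (k : fieldType) (k_char0 : [pchar k] =i pred0)
    (A : lmodType k) :
  exists Phi : AY_structure A -> Yamaguti_mult (End_operad A),
    bijective Phi /\
    forall (s : AY_structure A) (a b c : A),
      [/\ ym_pi (Phi s) (tnth [tuple a; b]) = ay_mul s a b,
          ym_theta (Phi s) (tnth [tuple a; b; c]) = ay_brl s a b c
        & ym_vartheta (Phi s) (tnth [tuple a; b; c]) = ay_brr s a b c].
Proof.
(* Choice turns the two existence lemmas into functions; the uniqueness lemmas make them inverse to
   each other. *)
have [Phi PhiP] := choice (@AY_to_Yamaguti k A).
have [Psi PsiP] := choice (@Yamaguti_to_AY k A).
exists Phi; split.
  exists Psi => [s|m].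
    exact: Yamaguti_to_AY_uniq (PsiP _) (PhiP s).
  exact: AY_to_Yamaguti_uniq (PhiP _) (PsiP m).
move=> s a b c; have [<- <- <-] := PhiP s.
(* Both sides apply the same multilinear map, to tuples read by [tnth] and by [nth 0]. *)
split; congr (_ _); apply: funext => i; rewrite (tnth_nth 0) //.
Qed.
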